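(* Let $(\mathfrak g_0,B_0,(\rho,V))$ be a fundamental triplet over $\mathbb C$ where $\mathfrak g_0$ is reductive and $\rho$ is completely reducible. Suppose that the local Lie algebra $\Gamma(\mathfrak g_0,B_0,\rho)$ is transitive. If $\dim\mathfrak g_{min}(\Gamma(\mathfrak g_0,B_0,\rho))$ is finite, then the Lie algebra $\mathfrak g_{min}(\Gamma(\mathfrak g_0,B_0,\rho))$ is semi-simple.
   Context: All vector spaces and Lie algebras are over $\mathbb C$. A quadratic Lie algebra is a pair $(\mathfrak g_0,B_0)$ where $\mathfrak g_0$ is a finite-dimensional Lie algebra and $B_0$ is a non-degenerate invariant symmetric bilinear form on $\mathfrak g_0$. A fundamental triplet $(\mathfrak g_0,B_0,(\rho,V))$ consists of a quadratic Lie algebra and a finite-dimensional representation $(\rho,V)$ of $\mathfrak g_0$; $(\rho^*,V^* )$ is the contragredient representation. A graded Lie algebra is a Lie algebra $\mathfrak g=\bigoplus_{i\in\mathbb Z}\mathfrak g_i$ with $\dim\mathfrak g_i<\infty$, $[\mathfrak g_i,\mathfrak g_j]\subset\mathfrak g_{i+j}$, generated by its local part $\mathfrak g_{-1}\oplus\mathfrak g_0\oplus\mathfrak g_1$. A local Lie algebra is a direct sum $\Gamma=\mathfrak g_{-1}\oplus\mathfrak g_0\oplus\mathfrak g_1$ of finite-dimensional spaces with bilinear anticommutative brackets $\mathfrak g_i\times\mathfrak g_j\to\mathfrak g_{i+j}$ for $i,j\in\{-1,0,1\}$ with $|i+j|\le1$, such that the Jacobi identity holds each time its three terms are defined. Morphisms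 are degree-preserving linear maps compatible with all (defined) brackets. By a theorem of Kac, for every local Lie algebra $\Gamma$ there is a unique graded Lie algebra $\mathfrak g_{max}(\Gamma)$ with local part $\Gamma$ such that every morphism of local Lie algebras from $\Gamma$ to the local part of a graded Lie algebra extends uniquely to a morphism of graded Lie algebras on $\mathfrak g_{max}(\Gamma)$. It has a unique maximal graded ideal $J_{max}$ with $J_{max}\cap\Gamma=\{0\}$, and $\mathfrak g_{min}(\Gamma):=\mathfrak g_{max}(\Gamma)/J_{max}$, with local part $\Gamma$. $\Gamma(\mathfrak g_0,B_0,\rho)=V^*\oplus\mathfrak g_0\oplus V$ (degrees $-1,0,1$) is the local Lie algebra with the bracket of $\mathfrak g_0$, $[U,X]=\rho(U)X$, $[U,Y]=\rho^*(U)Y$, and $[X,Y]\in\mathfrak g_0$ defined by $B_0([X,Y],U)=Y(\rho(U)X)$ for all $U\in\mathfrak g_0$ ($X\in V$, $Y\in V^*$). A local Lie algebra is transitive if: for $x\in\mathfrak g_i$ with $i\in\{0,1\}$, $[x,\mathfrak g_{-1}]=\{0\}$ implies $x=0$; and for $x\in\mathfrak g_i$ with $i\in\{-1,0\}$, $[x,\mathfrak g_1]=\{0\}$ implies $x=0$. *)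

(* Defs.v *)
From HB Require Import structures.
From mathcomp Require Import all_boot all_order all_algebra.
From mathcomp Require Import sesquilinear complex.
From mathcomp Require Import boolp classical_sets reals.

Set Implicit Arguments.
Unset Strict Implicit.
Unset Printing Implicit Defensive.

Import GRing.Theory.
Local Open Scope ring_scope.
Local Open Scope classical_set_scope.

HB.mixin Record Lmodule_isLieAlgebra (K : fieldType) (L : Type)
    of GRing.Lmodule K L := {
  lie : L -> L -> L;
  lie_bilinear : bilinear_for *:%R *:%R lie;
  liexx : forall x, lie x x = 0;
  lie_jacobi : forall x y z,
    lie x (lie y z) + lie y (lie z x) + lie z (lie x y) = 0
}.

#[short(type="lieAlgType")]
HB.structure Definition LieAlgebra (K : fieldType) :=
  {L of GRing.Lmodule K L & Lmodule_isLieAlgebra K L}.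

#[short(type="finLieAlgType")]
HB.structure Definition FinLieAlgebra (K : fieldType) :=
  {L of Vector K L & Lmodule_isLieAlgebra K L}.

Section LieTheory.
Context {K : fieldType}.
Implicit Type L : lieAlgType K.

Lemma lieDl L (z : L) : {morph lie^~ z : x y / x + y}.
Proof. by move=> x y; have := lie_bilinear.1 z 1 x y; rewrite /= !scale1r. Qed.

Lemma lieDr L (z : L) : {morph lie z : x y / x + y}.
Proof. by move=> x y; have := lie_bilinear.2 z 1 x y; rewrite /= !scale1r. Qed.

Lemma lieC L (x y : L) : lie x y = - lie y x.
Proof.
by have /eqP := liexx (x + y); rewrite lieDl !lieDr !liexx add0r addr0 addr_eq0 => /eqP.
Qed.

Lemma lie0r L (x : L) : lie x 0 = 0.
Proof. by apply: (addIr (lie x 0)); rewrite -lieDr !add0r. Qed.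

Lemma lieNr L (x y : L) : lie x (- y) = - lie x y.
Proof. by apply/eqP; rewrite -addr_eq0 -lieDr addNr lie0r. Qed.

Lemma lie_lie L (x y z : L) : lie (lie x y) z = lie x (lie y z) - lie y (lie x z).
Proof.
have /eqP := lie_jacobi x y z.
rewrite addr_eq0 (lieC z x) lieNr (lieC z (lie x y)) opprK => /eqP <-.
by [].
Qed.

Definition subspace (V : lmodType K) (A : set V) : Prop :=
  A 0 /\ forall (a : K) u v, A u -> A v -> A (a *: u + v).

Definition finite_dim (V : lmodType K) (A : set V) : Prop :=
  exists s : seq V, forall x, A x ->
    exists c : 'I_(size s) -> K, x = \sum_(i < size s) c i *: s`_i.

Definition lie_subalgebra L (A : set L) : Prop :=
  subspace A /\ forall x y, A x -> A y -> A (lie x y).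

Definition lie_ideal L (I : set L) : Prop :=
  subspace I /\ forall x y, I y -> I (lie x y).

Definition derived L (A : set L) : set L :=
  smallest (@subspace L) [set z | exists x y, [/\ A x, A y & z = lie x y]].

Definition solvable L (A : set L) : Prop :=
  exists n, iter n (@derived L) A `<=` [set 0].

Definition semisimple L : Prop :=
  forall I : set L, lie_ideal I -> solvable I -> I `<=` [set 0].

End LieTheory.

Record lieRep (K : fieldType) (L : lieAlgType K) (V : vectType K) := LieRep {
  rep :> L -> 'End(V);
  rep_linear : linear rep;
  rep_lie : forall x y, rep (lie x y) = ((rep x \o rep y) - (rep y \o rep x))%VF
}.

Section Representations.
Context {K : fieldType}.

Section CompletelyReducible.
Context {L : lieAlgType K} {V : vectType K} (rho : lieRep L V).

Definition stable_subspace (W : {vspace V}) : Prop :=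
  forall x, (rho x @: W <= W)%VS.

Definition irreducible_subspace (W : {vspace V}) : Prop :=
  [/\ W != 0%VS, stable_subspace W &
      forall U : {vspace V}, (U <= W)%VS -> stable_subspace U ->
        U = 0%VS \/ U = W].

Definition completely_reducible : Prop :=
  exists n (W : 'I_n -> {vspace V}),
    [/\ forall i, irreducible_subspace (W i), directv (\sum_i W i)
      & (\sum_i W i = fullv)%VS].

End CompletelyReducible.

Section Adjoint.
Context {g : finLieAlgType K}.

Fact lie_linearr (x : g) : linear (lie x).
Proof. exact: lie_bilinear.2. Qed.

HB.instance Definition _ (x : g) :=
  GRing.isLinear.Build K g g *:%R (lie x) (lie_linearr x).

Definition ad (x : g) : 'End(g) := linfun (lie x).

Fact ad_linear : linear ad.
Proof.
move=> a x y; apply/lfunP => z.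
by rewrite add_lfunE scale_lfunE !lfunE /=; apply: lie_bilinear.1.
Qed.

Fact ad_lie x y : ad (lie x y) = ((ad x \o ad y) - (ad y \o ad x))%VF.
Proof.
by apply/lfunP => z; rewrite add_lfunE opp_lfunE !comp_lfunE !lfunE /= lie_lie.
Qed.

Definition adjoint : lieRep g g := LieRep ad_linear ad_lie.

End Adjoint.

Definition reductive (g : finLieAlgType K) : Prop :=
  completely_reducible (@adjoint g).

End Representations.

(* Only one order of the arguments of each bracket is recorded, the other one
   being given by anticommutativity; bracket and Jacobi identity on
   loc0 x loc0 are those of the Lie algebra loc0.  The Jacobi identity involves
   only defined brackets exactly in degrees (0,0,0), (0,0,1), (0,0,-1) and
   (0,1,-1), up to order. *)
Record localLie (K : fieldType) := LocalLie {
  loc0 : finLieAlgType K;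
  locp : vectType K;  (* degree 1 *)
  locm : vectType K;  (* degree -1 *)
  br0p : loc0 -> locp -> locp;
  br0m : loc0 -> locm -> locm;
  brpm : locp -> locm -> loc0;
  br0p_bilinear : bilinear_for *:%R *:%R br0p;
  br0m_bilinear : bilinear_for *:%R *:%R br0m;
  brpm_bilinear : bilinear_for *:%R *:%R brpm;
  jacobi00p : forall u v x,
    br0p (lie u v) x = br0p u (br0p v x) - br0p v (br0p u x);
  jacobi00m : forall u v y,
    br0m (lie u v) y = br0m u (br0m v y) - br0m v (br0m u y);
  jacobi0pm : forall u x y,
    lie u (brpm x y) = brpm (br0p u x) y + brpm x (br0m u y)
}.

Definition transitive_local (K : fieldType) (G : localLie K) : Prop :=
  [/\ forall x : locp G, (forall y, brpm x y = 0) -> x = 0,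
      forall u : loc0 G, (forall y, br0m u y = 0) -> u = 0,
      forall y : locm G, (forall x, brpm x y = 0) -> y = 0
    & forall u : loc0 G, (forall x, br0p u x = 0) -> u = 0].

HB.mixin Record LieAlgebra_isGraded (K : fieldType) (L : Type)
    of LieAlgebra K L := {
  homog : int -> set L;
  homog_subspace : forall i, subspace (homog i);
  homog_finite_dim : forall i, finite_dim (homog i);
  homog_span : forall x : L, exists (s : seq int) (y : int -> L),
    (forall i, homog i (y i)) /\ x = \sum_(i <- s) y i;
  homog_direct : forall (s : seq int) (y : int -> L), uniq s ->
    (forall i, homog i (y i)) -> \sum_(i <- s) y i = 0 ->
    forall i, i \in s -> y i = 0;
  homog_lie : forall i j x y,
    homog i x -> homog j y -> homog (i + j) (lie x y);
  homog_generated :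
    smallest (@lie_subalgebra K L) (homog (-1) `|` homog 0 `|` homog 1) = setT
}.

#[short(type="gradedLieAlgType")]
HB.structure Definition GradedLieAlgebra (K : fieldType) :=
  {L of LieAlgebra K L & LieAlgebra_isGraded K L}.

Section Graded.
Context {K : fieldType}.

Definition graded_morphism (L M : gradedLieAlgType K) (F : L -> M) : Prop :=
  [/\ linear F, {morph F : x y / lie x y}
    & forall i x, homog i x -> homog i (F x)].

Definition local_part (L : gradedLieAlgType K) : set L :=
  [set x | exists a b c,
     [/\ homog (-1) a, homog 0 b, homog 1 c & x = a + b + c]].

Definition graded_ideal (L : gradedLieAlgType K) (J : set L) : Prop :=
  lie_ideal J /\
  forall x, J x -> exists (s : seq int) (y : int -> L),
    (forall i, homog i (y i) /\ J (y i)) /\ x = \sum_(i <- s) y i.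

Definition local_trivial_ideal (L : gradedLieAlgType K) (J : set L) : Prop :=
  graded_ideal J /\ J `&` @local_part L = [set 0].

(* Maximal for inclusion; such an ideal is in fact unique. *)
Definition is_Jmax (L : gradedLieAlgType K) (J : set L) : Prop :=
  local_trivial_ideal J /\
  forall J', local_trivial_ideal J' -> J `<=` J' -> J' = J.

Record localMorphism (G : localLie K) (L : gradedLieAlgType K) :=
  LocalMorphism {
  mor0 : {linear loc0 G -> L};
  morp : {linear locp G -> L};
  morm : {linear locm G -> L};
  mor0_homog : forall u, homog 0 (mor0 u);
  morp_homog : forall x, homog 1 (morp x);
  morm_homog : forall y, homog (-1) (morm y);
  mor00 : forall u v, mor0 (lie u v) = lie (mor0 u) (mor0 v);
  mor0p : forall u x, morp (br0p u x) = lie (mor0 u) (morp x);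
  mor0m : forall u y, morm (br0m u y) = lie (mor0 u) (morm y);
  morpm : forall x y, mor0 (brpm x y) = lie (morp x) (morm y)
}.

Definition local_isomorphism (G : localLie K) (L : gradedLieAlgType K)
    (f : localMorphism G L) : Prop :=
  [/\ injective (mor0 f), injective (morp f) & injective (morm f)] /\
  [/\ range (mor0 f) = homog 0, range (morp f) = homog 1
    & range (morm f) = homog (-1)].

(* The maximal graded Lie algebra of G is only determined up to isomorphism, by
   its universal property: L realizes it, iota identifying G with the local
   part of L. *)
Definition is_gmax (G : localLie K) (L : gradedLieAlgType K)
    (iota : localMorphism G L) : Prop :=
  local_isomorphism iota /\
  forall (M : gradedLieAlgType K) (f : localMorphism G M),
    exists! F : L -> M, graded_morphism F /\
      [/\ F \o mor0 iota =1 mor0 f, F \o morp iota =1 morp f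
        & F \o morm iota =1 morm f].

(* The quotient of the maximal graded Lie algebra by its maximal graded ideal
   meeting the local part trivially is presented by its projection: a
   surjective graded morphism having that ideal as kernel. *)
Definition is_gmin (G : localLie K) (M : gradedLieAlgType K) : Prop :=
  exists (L : gradedLieAlgType K) (iota : localMorphism G L) (p : L -> M),
    [/\ is_gmax iota, graded_morphism p, range p = setT
      & is_Jmax [set x | p x = 0]].

End Graded.

Record fundamentalTriplet (K : fieldType) := FundamentalTriplet {
  ft_g0 : finLieAlgType K;
  ft_B0 : {symmetric ft_g0};
  ft_nondegenerate : nondegenerate ft_B0;
  ft_invariant : forall u v w, ft_B0 (lie u v) w = ft_B0 u (lie v w);
  ft_V : vectType K;
  ft_rho : lieRep ft_g0 ft_V
}.

Section Gamma.
Context {K : fieldType} (T : fundamentalTriplet K).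

Local Notation g0 := (ft_g0 T).
Local Notation B0 := (ft_B0 T).
Local Notation V := (ft_V T).
Local Notation rho := (ft_rho T).
Local Notation Vdual := 'Hom(V, K^o).

Definition contragredient (u : g0) (y : Vdual) : Vdual := (- (y \o rho u))%VF.

(* [x, y] for x in V and y in V^* is the element of g0 representing, through
   the isomorphism B0_flat : g0 -> g0^*, the functional u |-> y(rho(u) x); see
   bracket_VVdualP for its defining property. *)
Definition B0_pairing (u v : g0) : K^o := B0 u v.
Definition moment_fun (x : V) (y : Vdual) (u : g0) : K^o := y (rho u x).

Fact B0_pairing_linear (u : g0) : linear (B0_pairing u).
Proof. by move=> a v w; rewrite /B0_pairing linearPr. Qed.

HB.instance Definition _ (u : g0) :=
  GRing.isLinear.Build K g0 K^o *:%R (B0_pairing u) (B0_pairing_linear u).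

Fact moment_fun_linear (x : V) (y : Vdual) : linear (moment_fun x y).
Proof.
move=> a u v.
by rewrite /moment_fun rep_linear add_lfunE scale_lfunE linearP.
Qed.

HB.instance Definition _ (x : V) (y : Vdual) :=
  GRing.isLinear.Build K g0 K^o *:%R (moment_fun x y) (moment_fun_linear x y).

Definition B0_flat (u : g0) : 'Hom(g0, K^o) := linfun (B0_pairing u).
Definition moment (x : V) (y : Vdual) : 'Hom(g0, K^o) :=
  linfun (moment_fun x y).

Fact B0_flat_linear : linear B0_flat.
Proof.
move=> a u v; apply/lfunP => w.
by rewrite add_lfunE scale_lfunE !lfunE /= /B0_pairing linearPl.
Qed.

HB.instance Definition _ :=
  GRing.isLinear.Build K g0 'Hom(g0, K^o) *:%R B0_flat B0_flat_linear.

Definition bracket_VVdual (x : V) (y : Vdual) : g0 :=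
  ((linfun B0_flat)^-1)%VF (moment x y).

Lemma B0_sym u v : B0 u v = B0 v u.
Proof. by rewrite hermC /= expr0 mul1r. Qed.

Lemma B0_inj u v : (forall w, B0 u w = B0 v w) -> u = v.
Proof.
move=> uv; apply/eqP; rewrite -subr_eq0 -memv0.
rewrite -(eqP (ft_nondegenerate T)).
by apply/mem_orthovP => w _; rewrite linearBl /= uv subrr.
Qed.

Lemma lker_B0_flat : lker (linfun B0_flat) == 0%VS.
Proof.
apply/lker0P => u v /lfunP uv; apply: B0_inj => w.
by have := uv w; do 4!rewrite lfunE /=.
Qed.

Lemma limg_B0_flat : limg (linfun B0_flat) = fullv.
Proof.
apply/eqP; rewrite eqEdim subvf limg_dim_eq ?(eqP lker_B0_flat) ?capv0 //.
by rewrite !dimvf /= {1}/dim /= /dim /= muln1.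
Qed.

Lemma bracket_VVdualP x y u : B0 (bracket_VVdual x y) u = y (rho u x).
Proof.
have : linfun B0_flat (bracket_VVdual x y) = moment x y.
  by apply: limg_lfunVK; rewrite limg_B0_flat memvf.
by move=> /lfunP /(_ u); do 3!rewrite lfunE /=.
Qed.

Fact ft_br0p_bilinear :
  bilinear_for *:%R *:%R (fun (u : g0) (x : V) => rho u x).
Proof.
split=> [x a u v|u a x y] /=; last by rewrite linearP.
by rewrite rep_linear add_lfunE scale_lfunE.
Qed.

Fact ft_br0m_bilinear : bilinear_for *:%R *:%R contragredient.
Proof.
split=> [y a u v|u a y z]; apply/lfunP => x;
  rewrite !lfun_simp ?rep_linear ?lfun_simp.
  by rewrite linearP opprD scalerN.
by rewrite opprD scalerN.
Qed.

Fact ft_brpm_bilinear : bilinear_for *:%R *:%R bracket_VVdual.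
Proof.
split=> [y a x z|x a y z] /=; apply: B0_inj => u;
  rewrite linearPl /= !bracket_VVdualP.
  by rewrite !linearP.
by rewrite add_lfunE scale_lfunE.
Qed.

Fact ft_jacobi00p (u v : g0) (x : V) :
  rho (lie u v) x = rho u (rho v x) - rho v (rho u x).
Proof. by rewrite rep_lie !lfun_simp. Qed.

Fact ft_jacobi00m u v y :
  contragredient (lie u v) y
  = contragredient u (contragredient v y) - contragredient v (contragredient u y).
Proof.
apply/lfunP => x; rewrite !lfun_simp ft_jacobi00p linearB /=.
by rewrite !opprK opprB.
Qed.

Fact ft_jacobi0pm u x y :
  lie u (bracket_VVdual x y)
  = bracket_VVdual (rho u x) y + bracket_VVdual x (contragredient u y).
Proof.
apply: B0_inj => w.
rewrite linearDl /= !bracket_VVdualP !lfun_simp lieC linearNl /=.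
rewrite ft_invariant bracket_VVdualP ft_jacobi00p linearB /=.
by rewrite opprB.
Qed.

Definition Gamma : localLie K :=
  LocalLie ft_br0p_bilinear ft_br0m_bilinear ft_brpm_bilinear
    ft_jacobi00p ft_jacobi00m ft_jacobi0pm.

End Gamma.

(* Main.v *)
Require Import Defs.
From HB Require Import structures.
From mathcomp Require Import all_boot all_order all_algebra.
From mathcomp Require Import complex.
From mathcomp Require Import boolp classical_sets reals.
From mathcomp Require Import zify.
Set Implicit Arguments.
Unset Strict Implicit.
Unset Printing Implicit Defensive.
Import Order.TTheory GRing.Theory.
Local Open Scope ring_scope.
Local Open Scope classical_set_scope.

(** Everything comes down to showing that an abelian ideal A of the minimal
    graded Lie algebra g is zero, because the last nonzero term of the derived
    series of a solvable ideal is an abelian ideal.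

    The ideal A need not be graded. It is replaced by the span J of the
    homogeneous components of highest degree of its elements. Since the leading
    term of a bracket [x, a], with x homogeneous, is the bracket of x with the
    leading term of a when that is nonzero, J is an ideal; it is graded by
    construction, it is abelian because two leading terms bracket to a component
    of the bracket of two elements of A, and it vanishes only if A does
    ([leading_ideal_eq0]).

    Let u lie in J_0. For every u' in J_0 and v in V, the element [u, v] is in J,
    so [u', [u, v]] = 0: the action of J_0 maps V into the subspace N of V that
    J_0 annihilates, and N is stable under g_0 because J_0 is an ideal of g_0. An
    irreducible summand W of V either lies in N, or meets N trivially; in the
    latter case J_0 W, contained in both W and N, is zero. Hence W lies in N in
    both cases, J_0 acts trivially on V, and J_0 = 0 by transitivity
    ([abelian_ideal_degree0]).

    Then [J_1, g_(-1)] and [J_(-1), g_1], contained in J_0, are zero, so that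
    transitivity also gives J_1 = J_(-1) = 0. A graded ideal of g whose
    intersection with the local part is zero is itself zero, since its preimage
    in the maximal graded Lie algebra would otherwise contradict the maximality
    of the ideal divided out ([gmin_ideal_eq0]). So J = 0, and A = 0. *)

(** * Subspaces and ideals *)

Section Subspaces.
Context {K : fieldType}.

Lemma subspaceD (V : lmodType K) (A : set V) : subspace A ->
  forall u v, A u -> A v -> A (u + v).
Proof. by move=> [_ sA] u v Au Av; rewrite -[u]scale1r; apply: sA. Qed.

Lemma subspaceZ (V : lmodType K) (A : set V) : subspace A ->
  forall a u, A u -> A (a *: u).
Proof. by move=> [A0 sA] a u Au; rewrite -[_ *: _]addr0; apply: sA. Qed.

(** Passes from subspaces given by predicates to those on which irreducibility
    is defined. A detachable subspace of largest dimension among those contained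
    in A exhausts A. *)
Lemma subspace_vspace (V : vectType K) (A : set V) : subspace A ->
  exists U : {vspace V}, forall x, x \in U <-> A x.
Proof.
move=> sA.
pose P n := `[< exists U : {vspace V}, \dim U = n /\ forall x, x \in U -> A x >].
have exP : exists n, P n.
  exists 0%N; apply/asboolP; exists 0%VS; split; first exact: dimv0.
  by move=> x; rewrite memv0 => /eqP ->; exact: sA.1.
have leP n : P n -> (n <= \dim {:V})%N.
  by move=> /asboolP[U [<- _]]; apply: dimvS; exact: subvf.
case: (ex_maxnP exP leP) => n /asboolP[U [dimU UA]] maxn.
exists U => x; split; first exact: UA.
move=> Ax; have /eqP -> : U == (U + <[x]>)%VS.
  rewrite eqEdim addvSl /= dimU; apply: maxn; apply/asboolP.
  exists (U + <[x]>)%VS; split=> // _ /memv_addP[u /UA Au [_ /vlineP[a ->] ->]].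
  by rewrite addrC; apply: sA.2.
by apply: (subvP (addvSr U <[x]>)); exact: memv_line.
Qed.

End Subspaces.

Section Ideals.
Context {K : fieldType}.
Implicit Type L : lieAlgType K.

Lemma lie0l L (y : L) : lie 0 y = 0.
Proof. by rewrite lieC lie0r oppr0. Qed.

Lemma lieZr L (x : L) a y : lie x (a *: y) = a *: lie x y.
Proof. by have := lie_bilinear.2 x a y 0; rewrite /= lie0r !addr0. Qed.

Lemma lieZl L (y : L) a x : lie (a *: x) y = a *: lie x y.
Proof. by rewrite lieC lieZr lieC scalerN opprK. Qed.

Lemma lie_suml L (I : Type) (s : seq I) (F : I -> L) y :
  lie (\sum_(i <- s) F i) y = \sum_(i <- s) lie (F i) y.
Proof. exact: (big_morph (lie^~ y) (lieDl y) (lie0l y)). Qed.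

Lemma lie_sumr L (I : Type) (s : seq I) (F : I -> L) x :
  lie x (\sum_(i <- s) F i) = \sum_(i <- s) lie x (F i).
Proof. exact: (big_morph (lie x) (lieDr x) (lie0r x)). Qed.

Lemma lie_ideall L (I : set L) : lie_ideal I ->
  forall x y, I x -> I (lie x y).
Proof.
move=> [sI iI] x y Ix; rewrite lieC -scaleN1r.
by apply: (subspaceZ sI); exact: iI.
Qed.

Definition abelian_set L (A : set L) : Prop :=
  forall x y, A x -> A y -> lie x y = 0.

Lemma derived_ideal L (I : set L) : lie_ideal I -> lie_ideal (derived I).
Proof.
move=> [sI iI].
have sD : subspace (derived I).
  split=> [B [[]]//|a u v Du Dv B BI].
  by apply: BI.1.2; [exact: Du|exact: Dv].
split=> // x y.
suff /(_ y) : derived I `<=` [set y | derived I (lie x y)] by apply.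
apply: smallest_sub; last first.
  move=> _ [a [b [Ia Ib ->]]] /=.
  have -> : lie x (lie a b) = lie (lie x a) b + lie a (lie x b).
    by rewrite lie_lie subrK.
  apply: (subspaceD sD); apply: sub_gen_smallest.
    by exists (lie x a), b; split=> //; exact: iI.
  by exists a, (lie x b); split=> //; exact: iI.
split=> [|a u v Du Dv] /=; first by rewrite lie0r; exact: sD.1.
by rewrite lieDr lieZr; apply: sD.2.
Qed.

(** The last nonzero term of the derived series of a nonzero solvable ideal is
    a nonzero abelian ideal. *)
Lemma semisimple_abelian L :
  (forall A : set L, lie_ideal A -> abelian_set A -> A `<=` [set 0]) ->
  semisimple L.
Proof.
move=> noA I + [n]; elim: n I => [//|n IHn] I idI.
rewrite iterSr => /(IHn _ (derived_ideal idI)) DI0.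
apply: noA => // x y Ix Iy; apply: DI0; apply: sub_gen_smallest.
by exists x, y.
Qed.

End Ideals.

(** * Homogeneous components *)

Section Components.
Context {K : fieldType} {L : gradedLieAlgType K}.
Implicit Types (x : L) (i j : int).

(** The family y vanishes off s, so that it is determined by x while s is not. *)
Definition decomposition x (y : int -> L) (s : seq int) : Prop :=
  [/\ uniq s, forall i, homog i (y i), forall i, i \notin s -> y i = 0
    & x = \sum_(i <- s) y i].

Lemma decomposition_exists x : exists (y : int -> L) s, decomposition x y s.
Proof.
have [s [y [hy ->]]] := homog_span x.
(* A degree may be listed several times in s. *)
exists (fun i => y i *+ count_mem i s), (undup s); split.
- exact: undup_uniq.
- by move=> i; rewrite -scaler_nat; apply: subspaceZ => //; exact: homog_subspace.
- by move=> i; rewrite mem_undup => /count_memPn ->; rewrite mulr0n.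
- by rewrite -big_undup_iterop_count.
Qed.

Lemma decomposition_widen x (y : int -> L) s t : decomposition x y s -> uniq t ->
  {subset s <= t} -> decomposition x y t.
Proof.
move=> [us hy y0 ->] ut st; split=> // [i it|].
  by apply: y0; apply: contra it; exact: st.
rewrite (perm_big [seq i <- t | i \in s]) /=; last first.
  apply: uniq_perm => // [|i]; first exact: filter_uniq.
  by rewrite mem_filter andb_idr //; exact: st.
rewrite big_filter big_mkcond; apply: eq_bigr => i _.
by case: ifPn => // /y0.
Qed.

Lemma decomposition_unique x (y y' : int -> L) s s' :
  decomposition x y s -> decomposition x y' s' -> y =1 y'.
Proof.
move=> d d'; pose t := undup (s ++ s').
have ut : uniq t by exact: undup_uniq.
have [|_ hy y0 xE] := decomposition_widen d ut.
  by move=> i si; rewrite mem_undup mem_cat si.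
have [|_ hy' y0' xE'] := decomposition_widen d' ut.
  by move=> i si; rewrite mem_undup mem_cat si orbT.
move=> i; have [it|it] := boolP (i \in t); last by rewrite y0 // y0'.
apply/eqP; rewrite -subr_eq0; apply/eqP.
apply: (homog_direct t (fun i => y i - y' i)) => // [j|].
  rewrite addrC -scaleN1r.
  by apply: (homog_subspace j).2; [exact: hy'|exact: hy].
by rewrite sumrB -xE -xE' subrr.
Qed.

Definition hcomp i x : L := projT1 (cid (decomposition_exists x)) i.

Lemma hcomp_decomposition x :
  exists s, decomposition x (hcomp^~ x) s.
Proof. exact: projT2 (cid (decomposition_exists x)). Qed.

Lemma hcomp_unique x (y : int -> L) s : decomposition x y s -> forall i, hcomp i x = y i.
Proof.
have [t d] := hcomp_decomposition x => d' i.
exact: decomposition_unique d d' i.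
Qed.

Lemma homog_hcomp i x : homog i (hcomp i x).
Proof. by have [s []] := hcomp_decomposition x. Qed.

Lemma hcomp_eq0 x : (forall i, hcomp i x = 0) -> x = 0.
Proof.
by move=> x0; have [s [_ _ _ ->]] := hcomp_decomposition x; rewrite big1.
Qed.

Fact hcomp_is_linear i : linear (hcomp i).
Proof.
move=> a x y; have [s dx] := hcomp_decomposition x.
have [t dy] := hcomp_decomposition y.
pose r := undup (s ++ t); have ur : uniq r by exact: undup_uniq.
have [|_ hx x0 xE] := decomposition_widen dx ur.
  by move=> j sj; rewrite mem_undup mem_cat sj.
have [|_ hy y0 yE] := decomposition_widen dy ur.
  by move=> j sj; rewrite mem_undup mem_cat sj orbT.
apply: (@hcomp_unique _ (fun j => a *: hcomp j x + hcomp j y) r); split=> //.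
- by move=> j; apply: (homog_subspace j).2.
- by move=> j jr; rewrite x0 // y0 // scaler0 addr0.
- by rewrite {1}xE {1}yE scaler_sumr big_split.
Qed.

HB.instance Definition _ i :=
  GRing.isLinear.Build K L L *:%R (hcomp i) (hcomp_is_linear i).

Lemma hcomp_homog i j x : homog i x -> hcomp j x = if j == i then x else 0.
Proof.
move=> hx; apply: (@hcomp_unique _ (fun j => if j == i then x else 0) [:: i]).
split=> // [k|k|]; last by rewrite big_seq1 eqxx.
  by case: eqVneq => [->//|_]; exact: (homog_subspace k).1.
by rewrite inE => /negPf ->.
Qed.

Lemma hcomp_lie_homog i j x (y : L) : homog i x ->
  hcomp j (lie x y) = lie x (hcomp (j - i) y).
Proof.
move=> hx; have [s [us hy y0 yE]] := hcomp_decomposition y.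
pose z k := lie x (hcomp (k - i) y).
apply: (@hcomp_unique _ z [seq i + k | k <- s]); split.
- by rewrite map_inj_uniq //; exact: addrI.
- move=> k; rewrite -[k in homog k](subrKC i); apply: homog_lie => //.
- move=> k ks; rewrite /z y0 ?lie0r //; apply: contra ks => ks.
  by apply/mapP; exists (k - i) => //; rewrite subrKC.
- rewrite {1}yE lie_sumr big_map; apply: eq_bigr => k _.
  by rewrite /z addrAC subrr add0r.
Qed.

(** The component of degree i + j is the sum over k of the brackets
    [x_k, y_(i+j-k)], in which k > i gives x_k = 0 and k < i gives
    y_(i+j-k) = 0. *)
Lemma hcomp_lie_top i j x (y : L) :
  (forall k, i < k -> hcomp k x = 0) -> (forall k, j < k -> hcomp k y = 0) ->
  hcomp (i + j) (lie x y) = lie (hcomp i x) (hcomp j y).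
Proof.
move=> x0 y0; have [s [us hx xs xE]] := hcomp_decomposition x.
rewrite {1}xE lie_suml linear_sum /=.
have E k : hcomp (i + j) (lie (hcomp k x) y)
         = if k == i then lie (hcomp i x) (hcomp j y) else 0.
  rewrite (hcomp_lie_homog _ _ (hx k)); case: eqVneq => [->|ki].
    by rewrite addrAC subrr add0r.
  have [ik|ki'] := ltP i k; first by rewrite x0 // lie0l.
  by rewrite y0 ?lie0r //; lia.
rewrite (eq_bigr _ (fun k _ => E k)); have [si|/xs ->] := boolP (i \in s).
  by rewrite (bigD1_seq i) //= eqxx big1 ?addr0 // => k /negPf ->.
by rewrite lie0l big1 // => k _; case: ifP.
Qed.

Definition hcomp_closed (J : set L) : Prop :=
  forall i x, J x -> J (hcomp i x).

Lemma hcomp_closed_graded (J : set L) :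
  lie_ideal J -> hcomp_closed J -> graded_ideal J.
Proof.
move=> idJ hJ; split=> // x Jx; have [s [_ hx _ xE]] := hcomp_decomposition x.
by exists s, (hcomp^~ x); split=> // i; split; [exact: hx|exact: hJ].
Qed.

End Components.

Lemma linear_packed (K : fieldType) (V W : lmodType K) (p : V -> W) :
  linear p -> exists pl : {linear V -> W}, p = pl.
Proof.
move=> linp.
pose pl : {linear V -> W} := HB.pack p (GRing.isLinear.Build K V W *:%R p linp).
by exists pl.
Qed.

Lemma graded_morphism_hcomp (K : fieldType) (L M : gradedLieAlgType K)
    (p : L -> M) : graded_morphism p ->
  forall i x, hcomp i (p x) = p (hcomp i x).
Proof.
move=> [/linear_packed[pl ->] _ hp] i x.
have [s [us hx x0 xE]] := hcomp_decomposition x.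
apply: (@hcomp_unique _ _ _ (fun i => pl (hcomp i x)) s); split=> //.
- by move=> j; apply: hp; exact: hx.
- by move=> j /x0 ->; exact: linear0.
- by rewrite {1}xE linear_sum.
Qed.

(** * The ideal of leading terms *)

Section LeadingTerms.
Context {K : fieldType} {L : gradedLieAlgType K} (A : set L).
Hypothesis idA : lie_ideal A.

(** The value x = 0 is allowed: for given i, the leading terms of the elements of
    A of degree at most i then form a subspace. *)
Definition leading_term (i : int) (x : L) : Prop :=
  exists a, [/\ A a, forall k, i < k -> hcomp k a = 0 & hcomp i a = x].

Definition leading_ideal : set L :=
  [set x | forall i, leading_term i (hcomp i x)].

Lemma leading_term_subspace i : subspace (leading_term i).
Proof.
split; first by exists 0; split=> [|k _|]; rewrite ?linear0 //; exact: idA.1.1.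
move=> c _ _ [a [Aa a0 <-]] [b [Ab b0 <-]]; exists (c *: a + b); split.
- exact: idA.1.2.
- by move=> k ik; rewrite linearP /= a0 // b0 // scaler0 addr0.
- by rewrite linearP.
Qed.

Lemma leading_ideal_lie_ideal : lie_ideal leading_ideal.
Proof.
have sJ : subspace leading_ideal.
  split=> [i|c x y Jx Jy i].
    by rewrite linear0; exact: (leading_term_subspace i).1.
  by rewrite linearP; apply: (leading_term_subspace i).2; [exact: Jx|exact: Jy].
split=> // x y Jy; have [s [_ hx _ ->]] := hcomp_decomposition x.
rewrite lie_suml; apply: (big_ind leading_ideal) => [|u v|j _].
- exact: sJ.1.
- exact: (subspaceD sJ).
move=> i; rewrite (hcomp_lie_homog _ _ (hx j)).
have [a [Aa a0 <-]] := Jy (i - j).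
exists (lie (hcomp j x) a); split; first exact: idA.2.
  move=> k ik; rewrite (hcomp_lie_homog _ _ (hx j)) a0 ?lie0r //; lia.
exact: (hcomp_lie_homog _ _ (hx j)).
Qed.

Lemma leading_term_ideal i x : homog i x -> leading_term i x -> leading_ideal x.
Proof.
move=> hx lx j; rewrite (hcomp_homog _ hx).
by case: eqVneq => [->//|_]; exact: (leading_term_subspace j).1.
Qed.

Lemma leading_ideal_hcomp_closed : hcomp_closed leading_ideal.
Proof.
by move=> i x Jx; apply: (leading_term_ideal (i := i)) => //; exact: homog_hcomp.
Qed.

Lemma leading_ideal_abelian : abelian_set A -> abelian_set leading_ideal.
Proof.
move=> abA x y Jx Jy; have [s [_ _ _ ->]] := hcomp_decomposition x.
have [t [_ _ _ ->]] := hcomp_decomposition y.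
rewrite lie_suml big1 // => i _; rewrite lie_sumr big1 // => j _.
have [a [Aa a0 <-]] := Jx i; have [b [Ab b0 <-]] := Jy j.
by rewrite -(hcomp_lie_top a0 b0) abA // linear0.
Qed.

Lemma seq_max (s : seq int) (P : pred int) : has P s ->
  exists m, [/\ m \in s, P m & forall i, i \in s -> P i -> i <= m].
Proof.
elim: s => [//|k s IHs] /=; have [hs _|/hasPn hs] := boolP (has P s); last first.
  rewrite orbF => Pk; exists k; split=> // [|i]; first exact: mem_head.
  by rewrite inE => /predU1P[->//|/hs /negPf ->].
have [m [ms Pm maxm]] := IHs hs; have [Pkm|Pkm] := boolP (P k && (m <= k)).
  have [Pk mk] := andP Pkm; exists k; split=> // [|i]; first exact: mem_head.
  by rewrite inE => /predU1P[->//|si Pi]; apply: le_trans mk; exact: maxm.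
exists m; split=> // [|i]; first by rewrite inE ms orbT.
rewrite inE => /predU1P[->|/maxm//] Pk.
by move: Pkm; rewrite Pk -ltNge => /ltW.
Qed.

Lemma leading_ideal_eq0 : leading_ideal `<=` [set 0] -> A `<=` [set 0].
Proof.
move=> J0 a Aa; apply: contrapT => a0.
have [s [_ ha as0 aE]] := hcomp_decomposition a.
have /seq_max[m [ms am0 maxm]] : has (fun i => hcomp i a != 0) s.
  apply: contrapT => /negP /hasPn s0; apply: a0; apply: hcomp_eq0 => i.
  have [/s0|/as0//] := boolP (i \in s).
  by rewrite negbK => /eqP.
move: am0; have -> : hcomp m a = 0; last by rewrite eqxx.
apply: J0; apply: (leading_term_ideal (ha m)); exists a; split=> // k mk.
have [ks|/as0//] := boolP (k \in s); apply/eqP; apply: contraTT mk => ak.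
by rewrite -leNgt; exact: maxm.
Qed.

End LeadingTerms.

(** * The minimal graded Lie algebra *)

Section Minimal.
Context {K : fieldType} {G : localLie K} {M : gradedLieAlgType K}.
Hypothesis hmin : is_gmin G M.

(** The preimage of J in the maximal graded Lie algebra contains the maximal
    ideal with trivial local part, and has trivial local part itself: the two
    are equal. *)
Lemma gmin_ideal_eq0 (J : set M) : lie_ideal J -> hcomp_closed J ->
  J `&` @local_part K M `<=` [set 0] -> J `<=` [set 0].
Proof.
move=> idJ hJ Jloc; have [L [iota [p [_ pM psurj [[_ N0] Nmax]]]]] := hmin.
have [linp liep hp] := pM; have [pl plE] := linear_packed linp; subst p.
have p0 : pl 0 = 0 by exact: linear0.
have idI : lie_ideal [set x | J (pl x)].
  split=> [|x y Jy /=]; last by rewrite liep; exact: idJ.2.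
  split=> [|a x y Jx Jy] /=; first by rewrite p0; exact: idJ.1.1.
  by rewrite linp; exact: idJ.1.2.
have kerE : [set x | J (pl x)] = [set x | pl x = 0].
  apply: Nmax => [|x /= ->]; last exact: idJ.1.1.
  split.
    apply: hcomp_closed_graded => // i x /= Jx.
    by rewrite -graded_morphism_hcomp //; exact: hJ.
  apply/seteqP; split=> [x [Jx lx]|_ ->]; last first.
    split; first by rewrite /= p0; exact: idJ.1.1.
    by exists 0, 0, 0; split; rewrite ?addr0 //; exact: (homog_subspace _).1.
  rewrite -N0; split=> //; apply: Jloc; split=> //.
  have [a [b [c [ha hb hc ->]]]] := lx; exists (pl a), (pl b), (pl c).
  by split; rewrite ?linearD //; exact: hp.
move=> x Jx; have [y _ yx] : range pl x by rewrite psurj.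
by rewrite -yx in Jx *; suff : [set x | pl x = 0] y by []; rewrite -kerE.
Qed.

(** The projection from the maximal graded Lie algebra is injective on the local
    part, which its kernel meets trivially, and reaches every homogeneous
    element of its target by a homogeneous element of the same degree. *)
Lemma gmin_local_isomorphism :
  exists f : localMorphism G M, local_isomorphism f.
Proof.
have [L [iota [p [[[[i0 ip im] [r0 rp rm]] _] pM psurj [[_ N0] _]]]]] := hmin.
have [linp liep hp] := pM; have [pl plE] := linear_packed linp; subst p.
have h0 i : homog i (0 : L) by exact: (homog_subspace i).1.
have ploc x : @local_part K L x -> pl x = 0 -> x = 0.
  by move=> lx px; suff : [set 0] x by []; rewrite -N0.
have inj i (U : lmodType K) (g : {linear U -> L}) :
    i \in [:: -1; 0; 1] -> injective g -> (forall u, homog i (g u)) ->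
    injective (pl \o g).
  move=> hi injg hg u v /= /eqP; rewrite -subr_eq0 -!linearB => /eqP/ploc guv.
  apply/eqP; rewrite -subr_eq0; apply/eqP; apply: injg; rewrite linear0.
  apply: guv; move: hi; rewrite !inE.
  by case/or3P => /eqP ei; [exists (g (u - v)), 0, 0|exists 0, (g (u - v)), 0
    |exists 0, 0, (g (u - v))]; split; rewrite ?add0r ?addr0 -?ei.
have rng i (U : Type) (g : U -> L) :
    range g = homog i -> range (pl \o g) = homog i.
  move=> rg; apply/seteqP; split=> [_ [u _ <-] /=|z hz].
    by apply: hp; rewrite -rg; exists u.
  have [x _ xz] : range pl z by rewrite psurj.
  have : homog i (hcomp i x) by exact: homog_hcomp.
  rewrite -rg => -[u _ gu]; exists u => //=.
  by rewrite gu -graded_morphism_hcomp // xz (hcomp_homog _ hz) eqxx.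
have [hm hm0] := (morm_homog iota, mor0_homog iota).
have hmp := morp_homog iota.
have M00 u v : (pl \o mor0 iota) (lie u v)
    = lie ((pl \o mor0 iota) u) ((pl \o mor0 iota) v).
  by rewrite /= mor00; exact: liep.
have M0p u x : (pl \o morp iota) (br0p u x)
    = lie ((pl \o mor0 iota) u) ((pl \o morp iota) x).
  by rewrite /= mor0p; exact: liep.
have M0m u y : (pl \o morm iota) (br0m u y)
    = lie ((pl \o mor0 iota) u) ((pl \o morm iota) y).
  by rewrite /= mor0m; exact: liep.
have Mpm x y : (pl \o mor0 iota) (brpm x y)
    = lie ((pl \o morp iota) x) ((pl \o morm iota) y).
  by rewrite /= morpm; exact: liep.
exists (@LocalMorphism K G M (pl \o mor0 iota) (pl \o morp iota)
  (pl \o morm iota) (fun u => hp _ _ (hm0 u)) (fun x => hp _ _ (hmp x))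
  (fun y => hp _ _ (hm y)) M00 M0p M0m Mpm).
split; split; [exact: (inj 0)|exact: (inj 1)|exact: (inj (-1))|exact: rng..].
Qed.

(** By transitivity, a nonzero element of degree 1 or -1 of the ideal has a
    nonzero bracket with some element of the opposite degree, and this bracket
    is an element of degree 0 of the ideal. *)
Lemma gmin_ideal_degree0 (J : set M) : transitive_local G ->
  lie_ideal J -> hcomp_closed J ->
  (forall x, J x -> homog 0 x -> x = 0) -> J `<=` [set 0].
Proof.
move=> [tp _ tm _] idJ hJ J0; apply: gmin_ideal_eq0 => // x [Jx].
have [f [[f0inj fpinj fminj] [r0 rp rm]]] := gmin_local_isomorphism.
have Jp y : J y -> homog 1 y -> y = 0.
  rewrite -rp => Jy [v _ vy]; rewrite -vy in Jy *.
  rewrite (tp v) ?linear0 // => w; apply: f0inj; rewrite linear0 morpm.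
  apply: J0; first exact: lie_ideall.
  by rewrite -morpm; exact: mor0_homog.
have Jm y : J y -> homog (-1) y -> y = 0.
  rewrite -rm => Jy [v _ vy]; rewrite -vy in Jy *.
  rewrite (tm v) ?linear0 // => w; apply: f0inj; rewrite linear0 morpm.
  apply: J0; first exact: idJ.2.
  by rewrite -morpm; exact: mor0_homog.
move=> [a [b [c [ha hb hc xE]]]].
(* The components of x lie in J because J is graded. *)
have comp i : hcomp i x = (if i == -1 then a else 0) + (if i == 0 then b else 0)
    + (if i == 1 then c else 0).
  by rewrite xE !linearD /= (hcomp_homog _ ha) (hcomp_homog _ hb) (hcomp_homog _ hc).
have Ja : J a by have := hJ (-1) _ Jx; rewrite comp !addr0.
have Jb : J b by have := hJ 0 _ Jx; rewrite comp /= add0r addr0.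
have Jc : J c by have := hJ 1 _ Jx; rewrite comp /= !add0r.
by rewrite /= xE (Jm a) // (J0 b) // (Jp c) // !addr0.
Qed.

End Minimal.

(** * Semisimplicity *)

Section CompleteReducibility.
Context {K : fieldType} {T : fundamentalTriplet K} {M : gradedLieAlgType K}.
Hypothesis hrho : completely_reducible (ft_rho T).

(** On each irreducible summand of V, an abelian ideal acts in degree 0 with
    square zero, which leaves only the zero action. *)
Lemma abelian_ideal_degree0 (f : localMorphism (Gamma T) M) (J : set M) :
  transitive_local (Gamma T) -> injective (morp f) ->
  lie_ideal J -> abelian_set J -> forall u, J (mor0 f u) -> u = 0.
Proof.
move=> [_ _ _ t0] finj idJ abJ.
pose N : set (ft_V T) :=
  [set v | forall u, J (mor0 f u) -> ft_rho T u v = 0].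
have sN : subspace N.
  split=> [u _|a v w Nv Nw u Ju]; first by rewrite linear0.
  by rewrite linearP /= Nv // Nw // scaler0 addr0.
have [U UN] := subspace_vspace sN.
have JN u v : J (mor0 f u) -> N (ft_rho T u v).
  move=> Ju w Jw; apply: finj; rewrite linear0.
  rewrite (mor0p f w (ft_rho T u v)) (mor0p f u v).
  by apply: abJ => //; exact: lie_ideall.
have [n [W [irrW _ sumW]]] := hrho.
have WU i : (W i <= U)%VS.
  have [W0 stW minW] := irrW i.
  have stWx x w : w \in W i -> ft_rho T x w \in W i.
    by move=> Ww; apply: (subvP (stW x)); exact: memv_img.
  (* W i :&: U is stable, so it is either zero or the whole of W i. *)
  have [|WU0|<-] := minW (W i :&: U)%VS (capvSl _ _); last exact: capvSr.
    move=> x; apply/subvP => _ /memv_imgP[w + ->].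
    rewrite !memv_cap => /andP[/stWx -> /UN Nw] /=; apply/UN => u Ju.
    have -> : ft_rho T u (ft_rho T x w)
        = ft_rho T (lie u x) w + ft_rho T x (ft_rho T u w).
      by rewrite ft_jacobi00p subrK.
    rewrite (Nw u) // linear0 addr0 Nw // mor00.
    exact: lie_ideall.
  apply/subvP => w Ww; apply/UN => u Ju; apply/eqP.
  rewrite -memv0 -WU0 memv_cap stWx //=; apply/UN; exact: JN.
move=> u Ju; apply: t0 => v; apply: (UN v).1 => //.
have : (\sum_i W i <= U)%VS by apply/subv_sumP => i _; exact: WU.
by rewrite sumW => /subvP; apply; exact: memvf.
Qed.

End CompleteReducibility.

Theorem proposition3p4p6 (R : realType) (T : fundamentalTriplet R[i])
    (hg0 : reductive (ft_g0 T)) (hrho : completely_reducible (ft_rho T))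
    (htrans : transitive_local (Gamma T))
    (gmin : gradedLieAlgType R[i]) (hmin : is_gmin (Gamma T) gmin)
    (hfin : finite_dim [set: gmin]) :
  semisimple gmin.
Proof.
apply: semisimple_abelian => A idA abA.
apply: (leading_ideal_eq0 idA).
have idJ := leading_ideal_lie_ideal idA.
apply: (gmin_ideal_degree0 hmin htrans idJ).
  exact: leading_ideal_hcomp_closed.
have [f [[_ fpinj _] [r0 _ _]]] := gmin_local_isomorphism hmin.
move=> x Jx; rewrite -r0 => -[u _ ux]; rewrite -ux in Jx *.
rewrite (abelian_ideal_degree0 hrho htrans fpinj idJ _ Jx) ?linear0 //.
exact: leading_ideal_abelian.
Qed.
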